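(* Let $E=(E^0,E^1,r,s)$ be a directed graph with no tails, and let $G^0\subset E^0$ be such that $E^0_{sing}\subseteq G^0$. Let $T$ be the subgraph of $E$ with $T^0:=E^0\setminus G^0$ and $T^1:=\{e\in E^1: s(e),r(e)\in T^0\}$. Then the following two sets of conditions on $G^0$ are equivalent. (I) $T$ is acyclic; (a) each vertex in $G^0$ is the source of at most one infinite path $\rho\in E^\infty$ such that $r(\rho_i)\in T^0$ for all $i\geq 1$; and for each $\mu\in T^\infty$: (b) $G^0\geq s(\mu)$; (c) $|r^{-1}(s(\mu_i))|=1$ for all $i$; and (d) if $e\in E^1$ and $r(e)=s(\mu)$, then $|s^{-1}(s(e))|<\infty$. (II) Both of the following hold: (1) if $\lambda\in E^*$ is a cycle, then $s(\lambda_i)\in G^0$ for some $i$; and (2) whenever $\mu,\nu\in E^\infty$ are distinct and acyclic: ($a'$) if $s(\mu)=s(\nu)\in G^0$, then $r(\mu_i)\in G^0$ or $r(\nu_i)\in G^0$ for some $i$; ($b'$) either $G^0\geq s(\mu)$ or $s(\mu_i)\in G^0$ for some $i$; ($c'$) if $|r^{-1}(s(\mu))|>1$, then $s(\mu_i)\in G^0$ for some $i$; ($d'$) if $|s^{-1}(s(\mu))|=\infty$, then $r(\mu_i)\in G^0$ for some $i$.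
   Context: A directed graph $E=(E^0,E^1,r,s)$ consists of countable sets $E^0$ (vertices) and $E^1$ (edges) and maps $r,s:E^1\to E^0$ (range and source). A sink is a vertex emitting no edges (i.e. $s^{-1}(v)=\emptyset$); an infinite emitter is a vertex emitting infinitely many edges; sinks and infinite emitters are called singularities, and $E^0_{sing}$ is the set of all singularities. A finite path of length $n\ge 1$ is $\alpha=\alpha_1\cdots\alpha_n$ with $\alpha_i\in E^1$, $r(\alpha_i)=s(\alpha_{i+1})$; $s(\alpha)=s(\alpha_1)$, $r(\alpha)=r(\alpha_n)$, $|\alpha|=n$. A vertex is a path of length zero with itself as source and range. $E^*$ is the set of finite paths (including vertices). $E^\infty$ is the set of infinite paths $\mu=\mu_1\mu_2\cdots$ with $r(\mu_i)=s(\mu_{i+1})$, and $s(\mu)=s(\mu_1)$. $T^\infty$ is defined in the same way for the graph $T$. Throughout, $r^{-1}$ and $s^{-1}$ refer to the range and source maps of $E$. A finite path $\alpha$ of positive length is a cycle if $s(\alpha)=r(\alpha)$ and $s(\alpha_i)\neq s(\alpha_j)$ for $i\neq j$. A graph or an infinite path is acyclic if it contains no cycle. An acyclic infinite path $\mu$ is a tail if each $s(\mu_i)$ emits only the edge $\mu_i$ and each $r(\mu_i)$ receives only the edge $\mu_i$. For $u,v\in E^0$, $u\geq v$ means there is a path in $E^*$ from $u$ to $v$; for $U\subseteq E^0$, $U\geq v$ means $u\geq v$ for some $u\in U$. *)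

(* Defs.v *)
From mathcomp Require Export all_boot.
From mathcomp Require Export boolp classical_sets functions cardinality.

Set Implicit Arguments.
Unset Strict Implicit.
Unset Printing Implicit Defensive.

Local Open Scope classical_set_scope.

Record digraph := Digraph {
  vertex : countType;
  edge : countType;
  src : edge -> vertex;
  rng : edge -> vertex }.

Definition sink (E : digraph) (v : vertex E) : Prop :=
  @src E @^-1` [set v] = set0.

Definition infinite_emitter (E : digraph) (v : vertex E) : Prop :=
  infinite_set (@src E @^-1` [set v]).

Definition singularities (E : digraph) : set (vertex E) :=
  [set v | sink v \/ infinite_emitter v].
Arguments singularities E : clear implicits.

(* [fpath u p v]: the edges of p, in order, form a path from u to v in E^*;
   for p = [::] this is the vertex u = v, the path of length zero. *)
Fixpoint fpath (E : digraph) (u : vertex E) (p : seq (edge E)) (v : vertex E) :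
    Prop :=
  match p with
  | [::] => u = v
  | e :: q => src e = u /\ fpath (rng e) q v
  end.

(* Infinite paths are indexed from 0: [mu i] is the edge mu_{i+1}. *)
Definition infinite_path (E : digraph) : set (nat -> edge E) :=
  [set mu | forall i, rng (mu i) = src (mu i.+1)].

Definition is_cycle (E : digraph) (p : seq (edge E)) : Prop :=
  [/\ p <> [::], exists v, fpath v p v & uniq [seq src e | e <- p]].

Definition acyclic_graph (E : digraph) : Prop :=
  forall p : seq (edge E), ~ is_cycle p.

(* No finite subpath mu_{m+1} ... mu_{m+n} is a cycle. *)
Definition acyclic_path (E : digraph) (mu : nat -> edge E) : Prop :=
  forall m n, ~ is_cycle [seq mu i | i <- iota m n].

Definition is_tail (E : digraph) (mu : nat -> edge E) : Prop :=
  [/\ infinite_path mu, acyclic_path mu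
    & forall i, @src E @^-1` [set src (mu i)] = [set mu i] /\
                @rng E @^-1` [set rng (mu i)] = [set mu i] ].

Definition reaches (E : digraph) (u v : vertex E) : Prop :=
  exists p, fpath u p v.

Definition set_reaches (E : digraph) (U : set (vertex E)) (v : vertex E) : Prop :=
  exists2 u, U u & reaches u v.

Section Subgraph.
Variables (E : digraph) (V : set (vertex E)).

Definition inner_edges : set (edge E) := [set e | V (src e) /\ V (rng e)].

Lemma inner_src (e : {e : edge E | e \in inner_edges}) : src (val e) \in V.
Proof. by apply/mem_set; case: (set_mem (valP e)). Qed.

Lemma inner_rng (e : {e : edge E | e \in inner_edges}) : rng (val e) \in V.
Proof. by apply/mem_set; case: (set_mem (valP e)). Qed.

Definition induced_subgraph : digraph :=
  @Digraph {v : vertex E | v \in V} {e : edge E | e \in inner_edges}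
    (fun e => exist _ (src (val e)) (inner_src e))
    (fun e => exist _ (rng (val e)) (inner_rng e)).

Definition vincl (v : vertex induced_subgraph) : vertex E := val v.

End Subgraph.

(* Main.v *)
(* A path all of whose ranges lie outside G0 is acyclic as soon as every cycle
   meets G0: a cycle on it visits only ranges of its own edges.  So every path
   that (I) speaks about is acyclic, and (a')-(d') apply to it and to its shifts.
   The second path nu, which (b')-(d') ignore, can be taken to be the shift
   of mu, which differs from mu because mu contains no loop. *)

Require Import Defs.

Local Open Scope classical_set_scope.
Local Open Scope card_scope.

Set Implicit Arguments.
Unset Strict Implicit.

Lemma infinite_path_shift (E : digraph) (mu : nat -> edge E) k :
  infinite_path mu -> infinite_path (fun i => mu (i + k)).
Proof. by move=> mu_path i; rewrite mu_path. Qed.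

Lemma acyclic_path_shift (E : digraph) (mu : nat -> edge E) k :
  acyclic_path mu -> acyclic_path (fun i => mu (i + k)).
Proof.
move=> mu_acyclic m n; suff -> : [seq mu (i + k) | i <- iota m n] =
    [seq mu i | i <- iota (k + m) n] by exact: mu_acyclic.
by rewrite iotaDl -map_comp; apply: eq_map => i /=; rewrite addnC.
Qed.

Lemma acyclic_path_shift_neq (E : digraph) (mu : nat -> edge E) :
  infinite_path mu -> acyclic_path mu -> mu <> (fun i => mu (i + 1)).
Proof.
move=> mu_path mu_acyclic /(congr1 (fun f => f 0)) mu01.
apply: (mu_acyclic 0 1); split=> //=; exists (src (mu 0)).
by split=> //; rewrite mu_path -mu01.
Qed.

Lemma fpath_iota (E : digraph) (mu : nat -> edge E) n m u v :
  fpath u [seq mu i | i <- iota m n.+1] v ->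
  src (mu m) = u /\ rng (mu (m + n)) = v.
Proof.
elim: n m u => [|n IHn] m u; first by rewrite addn0.
by case=> src_mu /IHn[_]; rewrite addSnnS.
Qed.

(** Supplies the existence half of (c): a vertex outside [G0] that [G0] reaches is the end of a
    nonempty path, so some edge enters it. *)
Lemma fpath_last (E : digraph) (p : seq (edge E)) u v :
  fpath u p v -> u = v \/ exists e, rng e = v.
Proof.
elim: p u => [|e p IHp] u /=; first by left.
by case=> _ /IHp[rng_e|]; right=> //; exists e.
Qed.

Lemma acyclic_path_rng (E : digraph) (G0 : set (vertex E)) (mu : nat -> edge E) :
  (forall lambda : seq (edge E), is_cycle lambda ->
     exists2 e, e \in lambda & G0 (src e)) ->
  infinite_path mu -> (forall i, ~ G0 (rng (mu i))) -> acyclic_path mu.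
Proof.
move=> cycG0 mu_path rngNG0 m n cyc.
have [e /mapP[k]] := cycG0 _ cyc.
rewrite mem_iota => /andP[le_mk _] -> {e}.
case: k le_mk => [|k _]; last by rewrite -mu_path; exact: rngNG0.
(* The edge [mu 0] has no predecessor on [mu], but a cycle containing it starts with it, so its
   source is also the range of the last edge of the cycle. *)
rewrite leqn0 => /eqP m0; case: n cyc => [[]//|n] [_ [v /fpath_iota[]]].
by rewrite m0 => -> <- _; exact: rngNG0.
Qed.

Section InducedSubgraph.
Variables (E : digraph) (V : set (vertex E)).
Let T := induced_subgraph V.

Lemma fpath_val (u v : vertex T) (p : seq (edge T)) :
  fpath (vincl u) [seq val e | e <- p] (vincl v) <-> fpath u p v.
Proof.
elim: p u => [|e p IHp] u /=; first by split=> [/val_inj|->].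
by split=> -[src_e /(IHp (rng e)) pathp]; split=> //;
  [exact/val_inj | rewrite -src_e].
Qed.

Lemma is_cycle_val (p : seq (edge T)) :
  is_cycle [seq val e | e <- p] <-> is_cycle p.
Proof.
have srcE : [seq src e | e <- [seq val e | e <- p]] =
    [seq vincl v | v <- [seq src e | e <- p]] by rewrite -!map_comp.
rewrite /is_cycle srcE map_inj_uniq; last exact: val_inj.
split=> -[p_neq0 [v pathp] uniqp].
  (* The base point [v] is only known as a vertex of [E]; being the source of the first edge, it
     comes from [T]. *)
  case: p {srcE} p_neq0 pathp uniqp => // e p _ pathp uniqp.
  have vE : v = vincl (src e) by case: pathp.
  by split=> //; exists (src e); apply/fpath_val; rewrite -vE.
split=> //; first by case: p p_neq0 {srcE pathp uniqp}.
by exists (vincl v); apply/fpath_val.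
Qed.

(** The range of each edge is the source of the next one or, for the last edge, the endpoint [v]. *)
Lemma fpath_inner_edges (p : seq (edge E)) u v :
  (forall e, e \in p -> V (src e)) -> V v -> fpath u p v ->
  forall e, e \in p -> inner_edges V e.
Proof.
elim: p u => [|e p IHp] u //= srcV Vv [src_e pathp].
have srcVp f : f \in p -> V (src f).
  by move=> fp; apply: srcV; rewrite inE fp orbT.
move=> f; rewrite inE => /orP[/eqP->|]; last exact: IHp pathp f.
split; first by apply: srcV; rewrite mem_head.
case: p {srcV IHp} pathp srcVp => [->//|g p] [<- _]; apply.
by rewrite mem_head.
Qed.

Lemma edges_lift (p : seq (edge E)) :
  (forall e, e \in p -> inner_edges V e) ->
  exists q : seq (edge T), [seq val e | e <- q] = p.
Proof.
elim: p => [|e p IHp] pV; first by exists [::].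
have [f fp|q <-] := IHp; first by apply: pV; rewrite inE fp orbT.
have eV : e \in inner_edges V by apply/mem_set/pV; rewrite mem_head.
by exists ((exist _ e eV : edge T) :: q).
Qed.

(** The endpoint of a cycle is the source of its first edge, so having all sources in [V] puts every
    edge in the subgraph. *)
Lemma cycle_lift (p : seq (edge E)) :
  is_cycle p -> (forall e, e \in p -> V (src e)) ->
  exists q : seq (edge T), is_cycle q.
Proof.
move=> cycp srcV; have [p_neq0 [v pathp] _] := cycp.
have Vv : V v.
  case: p p_neq0 srcV pathp {cycp} => // e p _ srcV [<- _].
  by apply: srcV; rewrite mem_head.
have [q qp] := edges_lift (fpath_inner_edges srcV Vv pathp).
by exists q; apply/is_cycle_val; rewrite qp.
Qed.

Lemma infinite_path_lift (mu : nat -> edge E) :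
  infinite_path mu -> (forall i, V (src (mu i))) ->
  exists2 mu' : nat -> edge T, infinite_path mu' & forall i, val (mu' i) = mu i.
Proof.
move=> mu_path srcV; have mem i : mu i \in inner_edges V.
  by apply/mem_set; split; rewrite ?mu_path.
exists (fun i => exist _ (mu i) (mem i)) => // i.
by apply: val_inj; exact: mu_path.
Qed.

Lemma infinite_path_val (mu : nat -> edge T) :
  infinite_path mu -> infinite_path (fun i => val (mu i)).
Proof. by move=> mu_path i; exact: (congr1 (@vincl E V) (mu_path i)). Qed.

Lemma vincl_in (v : vertex T) : V (vincl v).
Proof. exact: set_mem (valP v). Qed.

End InducedSubgraph.

Theorem proposition3p7 (E : digraph) (G0 : set (vertex E))
    (no_tails : forall mu : nat -> edge E, ~ is_tail mu)
    (sing_sub : singularities E `<=` G0) :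
  let T := induced_subgraph (~` G0) in
  (* (I) *)
  [/\ acyclic_graph T,
      (* (a) *)
      forall v : vertex E, G0 v ->
        is_subset1 [set rho | [/\ infinite_path rho, src (rho 0) = v
                                & forall i, (~` G0) (rng (rho i))]]
    & forall mu : nat -> edge T, infinite_path mu ->
      [/\ (* (b) *) set_reaches G0 (vincl (src (mu 0))),
          (* (c) *)
          forall i, @rng E @^-1` [set vincl (src (mu i))] #= `I_1
        & (* (d) *)
          forall e : edge E, rng e = vincl (src (mu 0)) ->
            finite_set (@src E @^-1` [set src e]) ] ]
  <->
  (* (II) *)
  (* (1) *)
  (forall lambda : seq (edge E), is_cycle lambda ->
     exists2 e, e \in lambda & G0 (src e)) /\
  (* (2) *)
  (forall mu nu : nat -> edge E,
     infinite_path mu -> infinite_path nu -> mu <> nu ->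
     acyclic_path mu -> acyclic_path nu ->
     [/\ (* (a') *)
         src (mu 0) = src (nu 0) -> G0 (src (mu 0)) ->
           exists i, G0 (rng (mu i)) \/ G0 (rng (nu i)),
         (* (b') *)
         set_reaches G0 (src (mu 0)) \/ (exists i, G0 (src (mu i))),
         (* (c') *)
         ~ (@rng E @^-1` [set src (mu 0)] #<= `I_1) ->
           exists i, G0 (src (mu i))
       & (* (d') *)
         infinite_set (@src E @^-1` [set src (mu 0)]) ->
           exists i, G0 (rng (mu i)) ]).
Proof.
move=> T; split.
  move=> [T_acyclic Ia IT]; split.
    move=> p cycp; apply: contrapT => pNG0.
    have [|q] := @cycle_lift _ (~` G0) p cycp; last exact: T_acyclic.
    by move=> e ep G0e; apply: pNG0; exists e.
  move=> mu nu mu_path nu_path mu_neq_nu _ _.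
  (* Either [mu] has a source in [G0], which settles (b') and (c') at once, or it is a path of [T],
     to which (b) and (c) apply. *)
  have lift_mu : (exists i, G0 (src (mu i))) \/
      exists2 mu' : nat -> edge T, infinite_path mu' &
        forall i, val (mu' i) = mu i.
    have [|/forallNP] := pselect (exists i, G0 (src (mu i))); first by left.
    by move/(@infinite_path_lift _ (~` G0) _ mu_path); right.
  split.
  - move=> src_eq G0mu; apply: contrapT => /forallNP rngNG0; apply: mu_neq_nu.
    by apply: (Ia _ G0mu); split=> // i G0i; apply: (rngNG0 i); [left|right].
  - case: lift_mu => [|[mu' mu'_path mu'E]]; [by right|left].
    by rewrite -mu'E; have [] := IT _ mu'_path.
  - case: lift_mu => // -[mu' mu'_path mu'E] []; rewrite -mu'E.
    by have [_ /(_ 0)/card_eqPle[]] := IT _ mu'_path.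
  - move=> infmu; apply: contrapT => /forallNP rngNG0; apply: infmu.
    (* The source of [mu 0] may lie in [G0], so only the shifted path is lifted to [T]; (d) is then
       applied to the edge [mu 0], which enters its initial vertex. *)
    have [|mu' mu'_path mu'E] :=
        @infinite_path_lift _ (~` G0) _ (infinite_path_shift 1 mu_path).
      by move=> i; rewrite addn1 -mu_path; exact: rngNG0.
    have [_ _] := IT _ mu'_path; apply.
    by rewrite mu_path -[1]/(0 + 1) -mu'E.
move=> [cycG0 II].
(* Only ranges are required to avoid [G0]: in (a) and (d) the path may start inside [G0]. *)
have IIs (mu : nat -> edge E) : infinite_path mu ->
    (forall i, ~ G0 (rng (mu i))) -> acyclic_path mu /\
    [/\ set_reaches G0 (src (mu 0)) \/ (exists i, G0 (src (mu i))),
        ~ (@rng E @^-1` [set src (mu 0)] #<= `I_1) -> exists i, G0 (src (mu i))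
      & finite_set (@src E @^-1` [set src (mu 0)])].
  move=> mu_path rngNG0; have mu_acyclic := acyclic_path_rng cycG0 mu_path rngNG0.
  split=> //.
  have [_ IIb IIc IId] := II _ _ mu_path (infinite_path_shift 1 mu_path)
    (acyclic_path_shift_neq mu_path mu_acyclic) mu_acyclic
    (acyclic_path_shift (k := 1) mu_acyclic).
  by split=> //; apply: contrapT => /IId[i]; exact: rngNG0.
split.
- move=> q /is_cycle_val/cycG0[_ /mapP[e _ ->]].
  exact: (vincl_in (src (e : edge T))).
- move=> v G0v mu nu [mu_path mu0 rng_mu] [nu_path nu0 rng_nu].
  apply: contrapT => mu_neq_nu.
  have [mu_acyclic _] := IIs _ mu_path rng_mu.
  have [nu_acyclic _] := IIs _ nu_path rng_nu.
  have [IIa _ _ _] := II _ _ mu_path nu_path mu_neq_nu mu_acyclic nu_acyclic.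
  by case: IIa; rewrite ?mu0 // => i [/rng_mu|/rng_nu].
move=> mu' mu'_path.
pose mu i : edge E := val (mu' i).
have mu_path : infinite_path mu := infinite_path_val mu'_path.
have srcNG0 i : ~ G0 (src (mu i)) := @vincl_in _ (~` G0) (src (mu' i)).
have rngNG0 i : ~ G0 (rng (mu i)) := @vincl_in _ (~` G0) (rng (mu' i)).
(* Proved for all [k], not just 0 as (b) asks, because (c) at index [k] needs an edge entering
   [src (mu k)]. *)
have reach k : set_reaches G0 (src (mu k)).
  have [_ [[//|[i /srcNG0//]] _ _]] := IIs _ (infinite_path_shift k mu_path)
    (fun i => rngNG0 (i + k)).
split; first exact: reach.
- move=> k; have [_ [_ IIc _]] := IIs _ (infinite_path_shift k mu_path)
    (fun i => rngNG0 (i + k)).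
  have le1 : @rng E @^-1` [set src (mu k)] #<= `I_1.
    by apply: contrapT => /IIc[i /srcNG0].
  (* For the lower bound in (c), the path from [G0] to [src (mu k)] cannot be empty, so its last
     edge [e] lies in the preimage. *)
  have [u G0u [p /fpath_last[uE|[e rng_e]]]] := reach k.
    by case: (srcNG0 k); rewrite -uE.
  rewrite card_eq_le le1 -(card_le_eql (@card_set1 _ e)).
  by apply: subset_card_le => _ ->.
- move=> e rng_e.
  (* Prepending [e] to [mu] makes [src e] the start of an infinite path whose ranges all avoid [G0],
     so by (d') it emits finitely many edges. *)
  pose emu i := if i is j.+1 then mu j else e.
  have emu_path : infinite_path emu by case=> [|i] //=; exact: mu_path.
  have [|_ [_ _]] // := IIs _ emu_path.
  by case=> [|i] /=; [rewrite rng_e; exact: (srcNG0 0) | exact: rngNG0].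
Qed.
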